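(* Let $G$ and $H$ be two arbitrary subcubic graphs. Then $tndi(G\circ H)\leq \Delta(G\circ H)+3$, where $G\circ H$ is the corona product of $G$ and $H$; that is, for some $k\le \Delta(G\circ H)+3$ the graph $G\circ H$ admits a neighbor vertex distinguishing $[k]$-total coloring.
   Context: All graphs are finite, simple and undirected, with at least one vertex. $\Delta(F)$ denotes the maximum degree of a graph $F$, and $F$ is subcubic if $\Delta(F)\le 3$. Corona product: given graphs $G$ and $H$ with $n_g=|V(G)|$, $n_h=|V(H)|$, $V(G)=\{v_1,\dots,v_{n_g}\}$ and $V(H)=\{u_1,\dots,u_{n_h}\}$, the corona product $G\circ H$ is obtained by taking one copy of $G$ and $n_g$ disjoint copies $H_1,\dots,H_{n_g}$ of $H$, and joining, for each $1\le j\le n_g$, the vertex $v_j$ of $G$ to every vertex $u_i^j$ ($1\le i\le n_h$) of $H_j$, where $u_i^j$ is the copy of $u_i$ in $H_j$. Total coloring: for a positive integer $k$, let $[k]=\{1,2,\dots,k\}$. A (proper) $[k]$-total coloring of a graph $F$ is a map $c:V(F)\cup E(F)\to[k]$ such that $c(x)\ne c(y)$ whenever $x,y\in V(F)\cup E(F)$ are two adjacent vertices, two distinct edges sharing an endpoint, or a vertex and an edge incident with it. For a vertex $v$ of $F$, let $S(v)=\{c(v)\}\cup\{c(e): e\in E(F),\ e\ni v\}$ be the set of colors appearing on $v$ and on the edges incident with $v$. The coloring $c$ is a neighbor vertex distinguishing total coloring if $S(u)\ne S(v)$ for every edge $uv\in E(F)$. $tndi(F)$ denotes the smallest positive integer $k$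 such that $F$ admits a neighbor vertex distinguishing $[k]$-total coloring. *)

(* Defs.v *)
From mathcomp Require Import all_boot.

Set Implicit Arguments.
Unset Strict Implicit.
Unset Printing Implicit Defensive.

Record sgraph := SGraph {
  svertex :> finType;
  adj : rel svertex;
  adj_sym : symmetric adj;
  adj_irr : irreflexive adj;
  sgraph_gt0 : 0 < #|svertex|
}.

Definition edges (F : sgraph) : {set {set F}} :=
  [set [set x; y] | x in F, y in F & adj x y].

Definition max_degree (F : sgraph) : nat := \max_(v : F) #|[set w | adj v w]|.

Definition subcubic (F : sgraph) : Prop := max_degree F <= 3.

Section Corona.
Variables G H : sgraph.

(* [inl v] is the vertex v of G; [inr (v, u)] is the copy of the vertex u of H
   lying in the copy of H attached to v. *)
Definition corona_adj : rel (G + G * H) := fun x y =>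
  match x, y with
  | inl v, inl w => adj v w
  | inl v, inr (w, _) => v == w
  | inr (v, _), inl w => v == w
  | inr (v, a), inr (w, b) => (v == w) && adj a b
  end.

Fact corona_adj_sym : symmetric corona_adj.
Proof.
move=> [v|[v a]] [w|[w b]] //=; rewrite 1?eq_sym //; first exact: adj_sym.
by rewrite adj_sym.
Qed.

Fact corona_adj_irr : irreflexive corona_adj.
Proof. by move=> [v|[v a]] /=; rewrite adj_irr ?andbF. Qed.

Fact corona_gt0 : 0 < #|{: G + G * H}|.
Proof. by rewrite card_sum addn_gt0 sgraph_gt0. Qed.

Definition corona : sgraph :=
  @SGraph (G + G * H)%type corona_adj corona_adj_sym corona_adj_irr corona_gt0.

End Corona.

Section TotalColoring.
Variable F : sgraph.

Definition edge : finType := {e : {set F} | e \in edges F}.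

(* The disjoint union V(F) + E(F). *)
Definition element : finType := (F + edge)%type.

Definition conflict : rel element := fun x y =>
  match x, y with
  | inl u, inl v => adj u v
  | inl u, inr e => u \in val e
  | inr e, inl u => u \in val e
  | inr e, inr f => (e != f) && (val e :&: val f != set0)
  end.

(* The color set {1, ..., k} is represented by 'I_k = {0, ..., k - 1}. *)
Section Colors.
Variables (k : nat) (c : {ffun element -> 'I_k}).

Definition proper_total_coloring : bool :=
  [forall x, forall y, conflict x y ==> (c x != c y)].

Definition color_set (v : F) : {set 'I_k} :=
  c (inl v) |: [set c (inr e) | e : edge & v \in val e].

Definition nvd_total_coloring : bool :=
  proper_total_coloring &&
  [forall u : F, forall v : F, adj u v ==> (color_set u != color_set v)].

End Colors.

Definition nvd_total_colorable (k : nat) : bool :=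
  [exists c : {ffun element -> 'I_k}, nvd_total_coloring c].

(* Giving all vertices and edges distinct colors always works. *)
Lemma nvd_total_colorable_ex : exists k, (0 < k) && nvd_total_colorable k.
Proof.
exists #|element|; apply/andP; split.
  by rewrite card_sum addn_gt0 sgraph_gt0.
apply/existsP; exists [ffun x => enum_rank x]; apply/andP; split.
  apply/forallP => x; apply/forallP => y; apply/implyP => xy.
  rewrite !ffunE; apply/eqP => /enum_rank_inj exy; move: xy; rewrite {}exy.
  by case: y => [v|e] /=; rewrite ?adj_irr ?eqxx.
apply/forallP => u; apply/forallP => v; apply/implyP => uv.
apply/eqP => /setP /(_ (enum_rank (inl u : element))).
rewrite !inE !ffunE eqxx /= => /esym /orP [/eqP /enum_rank_inj [euv]|].
  by move: uv; rewrite euv adj_irr.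
by case/imsetP => e _; rewrite ffunE => /enum_rank_inj.
Qed.

Definition tndi : nat := ex_minn nvd_total_colorable_ex.

Lemma tndiP : [/\ 0 < tndi, nvd_total_colorable tndi
  & forall k, 0 < k -> nvd_total_colorable k -> tndi <= k].
Proof.
rewrite /tndi; case: ex_minnP => m /andP [m0 mc] mmin; split=> // k k0 kc.
by apply: mmin; rewrite k0.
Qed.

End TotalColoring.

(* Main.v *)
Require Import Defs.
From mathcomp Require Import all_boot all_fingroup zify.

Set Implicit Arguments.
Unset Strict Implicit.
Unset Printing Implicit Defensive.

(** Let D be the maximum degree of G and n the number of vertices of H. Since
    the corona has maximum degree at least D + n, it is enough to color it with
    D + n + 3 colors. The palette consists of b = D + 1 edge colors 0, ..., D,
    of three extra colors b, b + 1, b + 2, and of n - 1 common pendant colors.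

    The base graph. By Vizing's theorem for maximum degree at most 3
    ([edge_coloring]) the edges of G are properly colored with the b edge
    colors, so that every vertex v misses some edge color m(v). Read the list
    b, b + 1, b + 2, m(v) cyclically, starting at the position q(v) given by a
    proper coloring q of the vertices of G with four colors. The first entry
    becomes the color of v, the second the color of one of its pendant edges
    (the other n - 1 of them receive the common pendant colors), and the last
    two remain absent from v ([reserve]). The set of extra colors seen by v is
    {b, b + 1}, {b + 1, b + 2}, {b + 2} or {b}, according to q(v); hence it
    determines q(v) and adjacent vertices of G are distinguished.

    The copies of H. In the copy attached to v only n + 3 colors are used: the n
    colors of the pendant edges, the color of v and the two reserved colors that
    v does not see. Renaming them, the problem depends on H alone: color H with the
    palette H + {0, 1, 2}, where the pendant edge at u has color u and the apex
    has color 0 ([cone_coloring]). If n >= 3, take a cyclic permutation s of the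
    vertices of H and give s u to the vertex u. A proper edge coloring of H with
    four colors uses 0, 1, 2 and one vertex e of H as its colors; this is
    compatible with the vertex and pendant colors if the edges with color e
    avoid e and the vertex p with s p = e. For n >= 5 the four colors make two
    vertices miss a common color, and these two vertices are taken as p and e;
    for n <= 4 three edge colors suffice ([edge_coloring_common_free]). Apart
    from e, the vertex u sees exactly the pendant colors u and s u, and these
    sets distinguish adjacent vertices of H; the apex differs from all of them,
    as it sees every pendant color. If n <= 2, one edge color is enough and the
    vertices get the colors 1 and 2. *)

(** * Edge colorings of graphs of maximum degree at most three *)

Section EdgeColoring.
Variables (F : sgraph) (d : nat).
Hypothesis deg_le : forall x : F, #|[set y | adj x y]| <= d.

Implicit Types (f : F -> F -> option 'I_d.+1) (x y u v w : F) (a b m : 'I_d.+1).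

(** Uncolored pairs have value None; non-edges are forced to be uncolored, so
    that the color classes are matchings described by the coloring alone. *)
Definition partial_edge_coloring f :=
  [/\ forall x y, f x y = f y x,
      forall x y, f x y -> adj x y
    & forall x y z a, f x y = Some a -> f x z = Some a -> y = z].

Definition free f x a := [forall y, f x y != Some a].

Lemma freeP f x a : reflect (forall y, f x y <> Some a) (free f x a).
Proof. by apply: (iffP forallP) => h y; apply/eqP. Qed.

(** Distinct colors that are not free at x sit on distinct edges at x. *)
Lemma card_free f x : d.+1 <= #|[set a | free f x a]| + #|[set y | f x y]|.
Proof.
have := cardsC [set a | free f x a]; rewrite card_ord => {1}<-; rewrite leq_add2l.
apply: leq_trans (leq_imset_card (fun y => odflt ord0 (f x y)) _).
apply/subset_leq_card/subsetP => a; rewrite !inE => /forallPn [y].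
by rewrite negbK => /eqP fxy; apply/imsetP; exists y; rewrite ?inE fxy.
Qed.

Lemma card_free_ge1 f x : partial_edge_coloring f -> 0 < #|[set a | free f x a]|.
Proof.
case=> _ sup _; have := card_free f x.
have : #|[set y | f x y]| <= #|[set y | adj x y]|.
  by apply/subset_leq_card/subsetP => y; rewrite !inE; apply: sup.
by have := deg_le x; lia.
Qed.

Lemma card_free_ge2 f x y : partial_edge_coloring f -> adj x y -> f x y = None ->
  1 < #|[set a | free f x a]|.
Proof.
case=> _ sup _ xy fxy; have := card_free f x.
have : #|[set z | f x z]| < #|[set z | adj x z]|.
  apply/proper_card/properP; split; last by exists y; rewrite !inE ?fxy.
  by apply/subsetP => z; rewrite !inE; apply: sup.
by have := deg_le x; lia.
Qed.

Definition recolor f u v a x y :=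
  if (x == u) && (y == v) || (x == v) && (y == u) then Some a else f x y.

Lemma recolor_proper f u v a : partial_edge_coloring f -> adj u v ->
  (forall y, f u y = Some a -> y = v) -> (forall y, f v y = Some a -> y = u) ->
  partial_edge_coloring (recolor f u v a).
Proof.
case=> sym sup prop uv fu fv; split=> [x y|x y|x y z c].
- by rewrite /recolor orbC [(y == v) && _]andbC [(y == u) && _]andbC sym.
- rewrite /recolor; case: ifP => [|_]; last exact: sup.
  by case/orP=> /andP [/eqP-> /eqP->] // _; rewrite adj_sym.
have uv' : u != v by apply: contraTneq uv => ->; rewrite adj_irr.
rewrite /recolor; have [exu|xu] /= := eqVneq x u; have [exv|xv] /= := eqVneq x v.
- by rewrite -exu exv eqxx in uv'.
- subst x; rewrite !orbF; case: eqVneq => [->|yv]; case: eqVneq => [->|zv] //.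
  + by case=> <- /fu.
  + by move=> h [e]; apply: fu; rewrite e.
  + exact: prop.
- subst x; case: eqVneq => [->|yv]; case: eqVneq => [->|zv] //.
  + by case=> <- /fv.
  + by move=> h [e]; apply: fv; rewrite e.
  + exact: prop.
- exact: prop.
Qed.

(** The edges of colors m and b form paths and cycles, and u, v, w are ends of
    paths in this graph, so that the component K of v contains at most one of
    u and w. Instead of following paths, consider the two involutions A and B
    that exchange the ends of the edges of color b and m respectively, and the
    permutation phi = A o B. As B fixes v, the component of v is its orbit under
    phi. If w = phi^i v is fixed by B then phi^(2i) v = v, and if u = phi^j v is
    fixed by A then phi^(2j) v = phi v. Together these give
    phi^i v = phi^(2ij) v = v, which contradicts w <> v. *)
Lemma kempe_chain f v w u m b : partial_edge_coloring f ->
  free f v m -> free f w m -> free f u b -> v != w ->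
  exists K : {set F}, [/\ v \in K, ~~ ((u \in K) && (w \in K))
    & forall x y, (f x y == Some m) || (f x y == Some b) -> (x \in K) = (y \in K)].
Proof.
case=> sym sup prop vm wm ub vw.
pose mate a x := odflt x [pick y | f x y == Some a].
have mateE a x y : f x y = Some a -> mate a x = y.
  rewrite /mate => fxy; case: pickP => [z /eqP /= fxz|/(_ y)]; last by rewrite fxy eqxx.
  exact: prop fxz fxy.
have mate_free a x : free f x a -> mate a x = x.
  by move=> /forallP fr; rewrite /mate; case: pickP => // y; rewrite (negPf (fr y)).
have mateK a : involutive (mate a).
  move=> x; rewrite {2}/mate; case: pickP => [y /eqP fxy|nf] /=.
    by apply: mateE; rewrite sym.
  by apply: mate_free; apply/forallP => y; rewrite nf.
pose A := perm (inv_inj (mateK b)); pose B := perm (inv_inj (mateK m)).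
have AE x : A x = mate b x by rewrite permE.
have BE x : B x = mate m x by rewrite permE.
have AA : (A * A = 1)%g by apply/permP => x; rewrite permM !AE perm1 mateK.
have BB : (B * B = 1)%g by apply/permP => x; rewrite permM !BE perm1 mateK.
pose phi := (B * A)%g.
(* Conjugation by B inverts phi: the group generated by A and B is dihedral. *)
have phiB i : (phi ^+ i * B = B * phi ^- i)%g.
  rewrite conjgC conjXg; congr (_ * _)%g; rewrite -expgVn; congr (_ ^+ _)%g.
  have Bi : (B^-1 = B)%g by apply/eqP; rewrite eq_invg_mul BB.
  have Ai : (A^-1 = A)%g by apply/eqP; rewrite eq_invg_mul AA.
  by rewrite /conjg invMg Ai Bi /phi !mulgA BB mul1g.
have Bv : B v = v by rewrite BE mate_free.
have Bphi i : B ((phi ^+ i)%g v) = (phi ^- i)%g v.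
  by rewrite -permM phiB permM Bv.
have Aphi i : A ((phi ^+ i)%g v) = phi ((phi ^- i)%g v).
  by rewrite permM -Bphi !BE mateK.
have inKV i : (phi ^- i)%g v \in porbit phi v.
  by rewrite -porbitV -expgVn mem_porbit.
have KB x : x \in porbit phi v -> B x \in porbit phi v.
  by case/porbitP => i ->; rewrite Bphi.
have KA x : x \in porbit phi v -> A x \in porbit phi v.
  case/porbitP => i ->; rewrite Aphi -eq_porbit_mem.
  by have := porbit_perm phi 1 ((phi ^- i)%g v); rewrite expg1 => ->; rewrite eq_porbit_mem.
exists (porbit phi v); split; first exact: porbit_id.
  apply/negP => /andP [/porbitP [j uj] /porbitP [i wi]].
  have e2i : (phi ^+ (i + i))%g v = v.
    have : B w = w by rewrite BE mate_free.
    by rewrite expgD permM -wi => <-; rewrite {1}wi Bphi -permM mulVg perm1.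
  have e2j : (phi ^+ (j + j))%g v = phi v.
    have : A u = u by rewrite AE mate_free.
    rewrite expgD permM -uj => <-; rewrite {1}uj Aphi.
    by rewrite -!permM -expgS expgSr mulgA mulVg mul1g.
  have powi n : (phi ^+ ((i + i) * n))%g v = v.
    by elim: n => [|n IHn]; rewrite ?muln0 ?perm1 // mulnS expgD permM e2i.
  have powj n : (phi ^+ ((j + j) * n))%g v = (phi ^+ n)%g v.
    elim: n => [|n IHn]; first by rewrite muln0.
    by rewrite mulnS expgD permM e2j -permM -expgS !expgSr !permM IHn.
  move/eqP: vw; apply; rewrite wi -powj.
  by have -> : (j + j) * i = (i + i) * j by lia.
have KS (s : {perm F}) x y : (s * s = 1)%g -> s x = y -> s y = x.
  by move=> ss <-; rewrite -permM ss perm1.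
move=> x y /orP [] /eqP fxy.
- have Bxy : B x = y by rewrite BE; apply: mateE.
  by apply/idP/idP => /KB; rewrite ?Bxy ?(KS _ _ _ BB Bxy).
- have Axy : A x = y by rewrite AE; apply: mateE.
  by apply/idP/idP => /KA; rewrite ?Axy ?(KS _ _ _ AA Axy).
Qed.

Definition kempe_swap f (K : {set F}) m b x y :=
  if x \in K then omap (tperm m b) (f x y) else f x y.

(** Exchanging two colors inside a component of the graph formed by these two
    colors keeps the coloring proper. *)
Lemma kempe_swap_proper f (K : {set F}) m b : partial_edge_coloring f ->
  (forall x y, (f x y == Some m) || (f x y == Some b) -> (x \in K) = (y \in K)) ->
  partial_edge_coloring (kempe_swap f K m b).
Proof.
case=> sym sup prop closedK; rewrite /kempe_swap; split=> [x y|x y|x y z c].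
- have := closedK x y; rewrite [f y x]sym.
  case: (x \in K); case: (y \in K) => //; case: (f x y) => //= c.
    case: tpermP => [->|->|//] ; rewrite eqxx ?orbT; by move/(_ isT).
  case: tpermP => [->|->|//] ; rewrite eqxx ?orbT; by move/(_ isT).
- by case: (x \in K); have := sup x y; case: (f x y).
- case: (x \in K); last exact: prop.
  case exy: (f x y) => [c1|] //= [<-]; case exz: (f x z) => [c2|] //= [/perm_inj e].
  by apply: prop exy _; rewrite exz e.
Qed.

Lemma kempe_swap_free f (K : {set F}) m b x c :
  free (kempe_swap f K m b) x c = free f x (if x \in K then tperm m b c else c).
Proof.
rewrite /free /kempe_swap; case: ifP => // _; apply: eq_forallb => y.
case: (f x y) => //= c'; congr (~~ _).
by apply/eqP/eqP => [[<-]|[->]]; rewrite tpermK.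
Qed.

Definition improvement f v w := exists f', [/\ partial_edge_coloring f',
  forall x y, f x y -> f' x y & f' v w].

Lemma improve_common f u v a : partial_edge_coloring f -> adj u v ->
  free f u a -> free f v a -> improvement f u v.
Proof.
move=> pf uv /freeP ua /freeP va; exists (recolor f u v a); split.
- by apply: recolor_proper => // y => [/ua|/va].
- by move=> x y fxy; rewrite /recolor; case: ifP.
- by rewrite /recolor !eqxx.
Qed.

(** A fan with two blades: once u w is recolored with b, the color a is free at
    both ends of u v. *)
Lemma improve_shift f u v w a b : partial_edge_coloring f -> adj u v ->
  f u v = None -> f u w = Some a -> free f v a -> free f u b -> free f w b ->
  improvement f u v.
Proof.
move=> pf uv fuv fuw va /freeP ub /freeP wb.
have [sym sup prop] := pf.
have uw : adj u w by apply: sup; rewrite fuw.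
have vw : v != w by apply: contra_eq_neq fuv => ->; rewrite fuw.
have nuv : v != u by apply: contraTneq uv => ->; rewrite adj_irr.
have pf' : partial_edge_coloring (recolor f u w b).
  by apply: recolor_proper => // y => [/ub|/wb].
have [||f' [pf'' ext col]] := @improve_common _ u v a pf' uv.
- apply/freeP => y; rewrite /recolor eqxx /=; case: ifP => [_ [eb]|].
    by apply: (ub w); rewrite eb.
  by move=> /negbT; rewrite negb_or => /andP [/eqP yw _] fuy; apply/yw/(prop u _ _ a).
- by apply/freeP => y; rewrite /recolor (negPf nuv) (negPf vw) /=; apply/freeP.
- exists f'; split=> // x y fxy; apply: ext; by rewrite /recolor; case: ifP.
Qed.

(** Vizing's argument. Since u v is uncolored, at least two colors are free at u
    and at least two at v. If none is common then, as there are at most four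
    colors, every color is free at u or at v. For a free at v, let w be the
    neighbor of u along a, and let m be free at w; m may be assumed not to be
    free at u, hence to be free at v. Take b free at u. Swapping b and m on the
    Kempe component of v makes b free at both u and v if the component avoids u;
    otherwise it avoids w, and then m becomes free at both u and w, so that a
    shift along the fan applies. *)
Lemma improve f u v : d <= 3 -> partial_edge_coloring f -> adj u v ->
  f u v = None -> improvement f u v.
Proof.
move=> d3 pf uv fuv; have [sym sup prop] := pf.
pose Fr x := [set a | free f x a].
have [dis|] := boolP [disjoint Fr u & Fr v]; last first.
  by case/pred0Pn=> a /=; rewrite !inE => /andP []; apply: improve_common.
have cover a : (a \in Fr u) || (a \in Fr v).
  have : Fr u :|: Fr v = setT.
    apply/eqP; rewrite eqEcard subsetT /= cardsT card_ord (cardsU _ _) disjoint_setI0 // cards0.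
    have := card_free_ge2 pf uv fuv.
    have := @card_free_ge2 f v u pf; rewrite adj_sym sym => /(_ uv fuv).
    by rewrite -/(Fr u) -/(Fr v); lia.
  by move/setP/(_ a); rewrite !inE.
have nboth a : free f u a -> ~~ free f v a.
  by move=> ua; have := disjointFr dis (_ : a \in Fr u); rewrite !inE => ->.
have [a] : exists a, a \in Fr v.
  by apply/card_gt0P; rewrite ltnW // (@card_free_ge2 _ _ u) // 1?adj_sym // sym.
have [b] : exists b, b \in Fr u.
  by apply/card_gt0P; rewrite ltnW // (@card_free_ge2 _ _ v) // 1?adj_sym // sym.
rewrite !inE => ub va.
have [w fuw] : exists w, f u w = Some a.
  have : ~~ free f u a by apply/negP => /nboth; rewrite va.
  by case/forallPn => w; rewrite negbK => /eqP; exists w.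
have [m] : exists m, m \in Fr w by apply/card_gt0P; apply: card_free_ge1.
rewrite inE => wm.
have shift := improve_shift pf uv fuv fuw va.
have [um|um] := boolP (free f u m); first exact: shift wm.
have vm : free f v m by have := cover m; rewrite !inE (negPf um).
have [wb|wb] := boolP (free f w b); first exact: shift wb.
have vw : v != w by apply: contra_eq_neq fuv => ->; rewrite fuw.
have [K [vK uwK closedK]] := kempe_chain pf vm wm ub vw.
pose g := kempe_swap f K m b.
have pg : partial_edge_coloring g by apply: kempe_swap_proper.
suff [f' [pf' ext col]] : improvement g u v.
  exists f'; split=> // x y fxy; apply: ext; rewrite /g /kempe_swap.
  by case: ifP => //; case: (f x y) fxy.
have am : m != a by apply: contraTneq wm => ->; apply/forallPn; exists u; rewrite sym fuw eqxx.
have ab : b != a by apply: contraTneq ub => ->; apply/forallPn; exists w; rewrite fuw eqxx.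
have [uK|uK] := boolP (u \in K); last first.
  by apply: (@improve_common _ u v b); rewrite // kempe_swap_free ?(negPf uK) ?vK ?tpermR.
have wK : w \notin K by move: uwK; rewrite uK.
apply: (@improve_shift _ u v w a m) => //.
- by rewrite /g /kempe_swap uK fuv.
- by rewrite /g /kempe_swap uK fuw /= tpermD.
- by rewrite kempe_swap_free vK tpermD.
- by rewrite kempe_swap_free uK tpermL.
- by rewrite kempe_swap_free (negPf wK).
Qed.

(** Vizing's theorem for maximum degree at most three, by iterating [improve]
    from the empty coloring. *)
Lemma edge_coloring : d <= 3 -> exists f : F -> F -> 'I_d.+1,
  (forall x y, f x y = f y x) /\
  (forall x y z, adj x y -> adj x z -> f x y = f x z -> y = z).
Proof.
move=> d3.
have [f [[sym sup prop] tot]] : exists f, partial_edge_coloring f /\ forall x y, adj x y -> f x y.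
  pose uncol f := [set p : F * F | adj p.1 p.2 && ~~ f p.1 p.2].
  suff main n f : #|uncol f| <= n -> partial_edge_coloring f ->
      exists f', partial_edge_coloring f' /\ forall x y, adj x y -> f' x y.
    by apply: (main _ (fun _ _ => None) (leqnn _)); split.
  elim: n f => [|n IHn] f un pf.
    exists f; split=> // x y xy; apply/idPn => fxy.
    move: un; rewrite leqn0 cards_eq0 => /eqP/setP/(_ (x, y)).
    by rewrite !inE /= xy fxy.
  have [/pred0P un0|/pred0Pn [[x y]]] := boolP (pred0b (mem (uncol f))).
    by apply: (IHn f) => //; rewrite eq_card0.
  rewrite !inE /= => /andP [xy fxy].
  have [|f' [pf' ext col]] := improve d3 pf xy; first by case: (f x y) fxy.
  apply: (IHn f') => //; rewrite -ltnS; apply: leq_trans un.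
  apply/proper_card/properP; split; last by exists (x, y); rewrite !inE /= xy ?col.
  apply/subsetP => -[x' y']; rewrite !inE /= => /andP [-> /=].
  exact/contra/ext.
exists (fun x y => odflt ord0 (f x y)); split=> [x y|x y z /tot xy /tot xz]; first by rewrite sym.
case exy: (f x y) xy => [c|] // _; case exz: (f x z) xz => [c'|] //= _ e.
by apply: prop exy _; rewrite exz e.
Qed.
End EdgeColoring.

(** * Greedy vertex colorings and missing colors *)

Definition rank (F : sgraph) (x : F) : nat := enum_rank x.

Lemma rank_inj (F : sgraph) : injective (@rank F).
Proof. by move=> x y /val_inj/enum_rank_inj. Qed.

Lemma rank_lt (F : sgraph) (x : F) : rank x < #|F|.
Proof. exact: ltn_ord. Qed.

Lemma rank_eq0 (F : sgraph) : exists x : F, rank x = 0.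
Proof.
pose i0 := Ordinal (sgraph_gt0 F); exists (enum_val i0).
by rewrite /rank enum_valK.
Qed.

Lemma degree_le (F : sgraph) (x : F) : #|[set y | adj x y]| <= max_degree F.
Proof. exact: (leq_bigmax (F := fun v : F => #|[set w | adj v w]|)). Qed.

Lemma color_avoiding (T : finType) (d : nat) (A : {set T}) (q : T -> 'I_d.+1) :
  #|A| <= d -> exists a, forall y, y \in A -> q y != a.
Proof.
move=> Ad; have [a aN] : exists a, a \notin [set q y | y in A].
  apply/existsP; rewrite -[[exists _, _]]negbK negb_exists; apply/negP => /forallP full.
  have := leq_imset_card q A; suff -> : [set q y | y in A] = setT.
    by rewrite cardsT card_ord leqNgt ltnS Ad.
  by apply/setP => a; have := full a; rewrite negbK inE.
by exists a => y yA; apply: contraNneq aN => <-; apply: imset_f.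
Qed.

Lemma missing_color (F : sgraph) (d : nat) (f : F -> F -> 'I_d.+1) :
  (forall x : F, #|[set y | adj x y]| <= d) ->
  exists m : F -> 'I_d.+1, forall x y, adj x y -> f x y != m x.
Proof.
move=> deg; have mP x : exists a, [forall y, adj x y ==> (f x y != a)].
  have [a aP] := color_avoiding (f x) (deg x).
  by exists a; apply/forallP => y; apply/implyP => xy; apply: aP; rewrite inE.
by exists (fun x => xchoose (mP x)) => x y xy; have /forallP/(_ y) := xchooseP (mP x); rewrite xy.
Qed.

(** Coloring the vertices one after the other never gets stuck: at most d of the
    d + 1 colors occur on the neighbors of the next vertex. *)
Lemma vertex_coloring (F : sgraph) (d : nat) :
  (forall x : F, #|[set y | adj x y]| <= d) ->
  exists q : F -> 'I_d.+1, forall x y, adj x y -> q x != q y.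
Proof.
move=> deg.
suff main (s : seq F) : exists q : F -> 'I_d.+1,
    forall x y, x \in s -> y \in s -> adj x y -> q x != q y.
  by have [q qP] := main (enum F); exists q => x y; apply: qP; rewrite mem_enum.
elim: s => [|x s [q qP]]; first by exists (fun=> ord0).
have [a aN] := color_avoiding q (deg x).
have aP y : adj x y -> a != q y by move=> xy; rewrite eq_sym aN ?inE.
exists (fun y => if y == x then a else q y) => y z; rewrite !inE.
case: eqVneq => [->|yx] /= ys; case: eqVneq => [->|zx] //= zs yz.
- by rewrite adj_irr in yz.
- exact: aP.
- by rewrite eq_sym aP // adj_sym.
- exact: qP.
Qed.

(** * Total colorings as pairs of functions *)

Section Sees.
Variables (F : sgraph) (C : eqType) (cv : F -> C) (ce : F -> F -> C).

Definition sees (v : F) (a : C) := (a == cv v) || [exists w, adj v w && (a == ce v w)].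

Lemma seesP v a :
  reflect (a = cv v \/ exists2 w, adj v w & a = ce v w) (sees v a).
Proof.
apply: (iffP orP) => [] [/eqP|h]; try by left.
- by case/existsP: h => w /andP [vw /eqP ->]; right; exists w.
- by right; case: h => w vw ->; apply/existsP; exists w; rewrite vw eqxx.
Qed.

(** The function ce matters on adjacent pairs only. *)
Definition proper_coloring :=
  [/\ forall x y, adj x y -> ce x y = ce y x,
      forall x y, adj x y -> cv x != cv y,
      forall x y, adj x y -> ce x y != cv x
    & forall x y z, adj x y -> adj x z -> ce x y = ce x z -> y = z].

End Sees.

Lemma edgeP (F : sgraph) (e : edge F) : exists2 p : F * F, adj p.1 p.2 & val e = [set p.1; p.2].
Proof.
case: e => e /= /imset2P [x y _]; rewrite !inE /= => xy ->.
by exists (x, y).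
Qed.

(** Passage from the functional description to the colorings of the disjoint
    union of the vertex set and the edge set: an edge gets the value of ce at
    any ordered pair of its ends. *)
Lemma nvd_total_colorable_intro (F : sgraph) (k : nat) (cv : F -> nat) (ce : F -> F -> nat) :
  (forall x, cv x < k) -> (forall x y, adj x y -> ce x y < k) ->
  proper_coloring cv ce -> (forall x y, adj x y -> ~ sees cv ce x =1 sees cv ce y) ->
  nvd_total_colorable F k.
Proof.
case: k => [|k] cvk cek [sym pv pve pe] dist.
  by case/card_gt0P: (sgraph_gt0 F) => x; have := cvk x.
pose ec (e : edge F) :=
  if [pick p : F * F | adj p.1 p.2 && (val e == [set p.1; p.2])] is Some p
  then ce p.1 p.2 else 0.
have ecE (e : edge F) x y : adj x y -> val e = [set x; y] -> ec e = ce x y.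
  move=> xy exy; rewrite /ec; case: pickP => [[x' y'] /andP [/= xy' /eqP]|/(_ (x, y))]; last first.
    by rewrite /= xy exy eqxx.
  rewrite exy => e2.
  have : x \in [set x'; y'] by rewrite -e2 set21.
  have : y \in [set x'; y'] by rewrite -e2 set22.
  rewrite !inE => /orP [] /eqP ey /orP [] /eqP ex; subst x y => //.
  - by rewrite adj_irr in xy.
  - exact: sym.
  - by rewrite adj_irr in xy.
have edge_at (e : edge F) x : x \in val e -> exists2 y, adj x y & val e = [set x; y].
  have [[y z] /= yz ->] := edgeP e; rewrite !inE => /orP [] /eqP ->; first by exists z.
  by exists y; rewrite 1?adj_sym // setUC.
have edge_of x y : adj x y -> exists e : edge F, val e = [set x; y].
  move=> xy; have eP : [set x; y] \in edges F by apply: imset2_f; rewrite ?inE.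
  by exists (exist (fun e => e \in edges F) _ eP).
have ecP (e : edge F) : ec e < k.+1.
  by have [[x y] /= xy exy] := edgeP e; rewrite (ecE _ _ _ xy exy) cek.
pose c : {ffun element F -> 'I_k.+1} :=
  [ffun z => inord (match z with inl x => cv x | inr e => ec e end)].
have inord_inj a b : a < k.+1 -> b < k.+1 -> inord a = inord b :> 'I_k.+1 -> a = b.
  by move=> ak bk /(congr1 val); rewrite /= !inordK.
have ve x (e : edge F) : x \in val e -> cv x != ec e.
  by move/edge_at=> [y xy exy]; rewrite (ecE _ _ _ xy exy) eq_sym pve.
apply/existsP; exists c; apply/andP; split.
  apply/forallP => x; apply/forallP => y; apply/implyP => xy; rewrite !ffunE.
  apply/eqP => /inord_inj; case: x y xy => [x|e] [y|e'] //= xy.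
  - by move/(_ (cvk _) (cvk _))/eqP; apply/negP/pv.
  - by move/(_ (cvk _) (ecP _))/eqP; apply/negP/ve.
  - by move/(_ (ecP _) (cvk _))/esym/eqP; apply/negP/ve.
  - move/(_ (ecP _) (ecP _)); case/andP: xy => ne /set0Pn [x].
    rewrite inE => /andP [/edge_at [y xy exy] /edge_at [z xz exz]].
    rewrite (ecE _ _ _ xy exy) (ecE _ _ _ xz exz) => /(pe _ _ _ xy xz) yz.
    by case/eqP: ne; apply/val_inj; rewrite exy exz yz.
have seesE x a : a < k.+1 -> (inord a \in color_set c x) = sees cv ce x a.
  move=> ak; apply/setU1P/seesP => [[|/imsetP [e xe]]|].
  - by rewrite ffunE => /inord_inj -> //; left.
  - rewrite ffunE => /inord_inj -> //; right; move: xe; rewrite inE => /edge_at [y xy exy].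
    by exists y; rewrite ?(ecE _ _ _ xy exy).
  - case=> [->|[y xy ->]]; [left|right]; first by rewrite ffunE.
    have [e exy] := edge_of x y xy; apply/imsetP; exists e; first by rewrite inE exy set21.
    by rewrite ffunE (ecE _ _ _ xy exy).
apply/forallP => x; apply/forallP => y; apply/implyP => xy; apply/eqP => exy.
apply: (dist _ _ xy) => a.
have [ak|ka] := ltnP a k.+1; first by rewrite -!seesE // exy.
have out z : sees cv ce z a = false.
  apply/negP => /seesP [ea|[w zw ea]]; move: ka; rewrite ea leqNgt.
    by rewrite cvk.
  by rewrite cek.
by rewrite !out.
Qed.

(** * Coloring one copy of H together with its pendant edges *)

(** The elements are arranged in a cycle, in which q follows p. *)
Lemma cyclic_shift (T : finType) (p q : T) : p != q -> 2 < #|T| ->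
  exists s : T -> T, [/\ injective s, s p = q, forall x, s x != x & forall x, s (s x) != x].
Proof.
move=> pq T3; pose l := p :: q :: enum [predC [:: p; q]].
have Ul : uniq l.
  by rewrite /= !inE !mem_enum !inE negb_or pq !eqxx orbT /= enum_uniq.
have inl x : x \in l.
  by rewrite !inE mem_enum !inE; case: eqP => //= _; case: eqP.
have sl : 2 < size l.
  apply: leq_trans T3 _; rewrite cardE; apply: uniq_leq_size; first exact: enum_uniq.
  by move=> x _; apply: inl.
exists (next l); split; first exact: can_inj (prev_next Ul).
- by rewrite /= eqxx.
- move=> x; have [i l' e] := rot_to (inl x).
  have Ur : uniq (x :: l') by rewrite -e rot_uniq.
  have sr : 2 < size (x :: l') by rewrite -e size_rot.
  rewrite -(next_rot i Ul) e; case: l' Ur sr {e} => [|y l'] //= /andP [xl _] _.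
  by rewrite eqxx eq_sym; apply: contraNneq xl => ->; rewrite inE eqxx.
- move=> x; have [i l' e] := rot_to (inl x).
  have Ur : uniq (x :: l') by rewrite -e rot_uniq.
  have sr : 2 < size (x :: l') by rewrite -e size_rot.
  rewrite -!(next_rot i Ul) e; case: l' Ur sr {e} => [|y [|z l']] //= /and3P [xl _ _] _.
  rewrite !eqxx; case: (y =P x) => [yx|_]; first by rewrite yx !inE eqxx in xl.
  by apply: contraNneq xl => ->; rewrite !inE eqxx orbT.
Qed.

(** The three perfect matchings of the complete graph on {0, 1, 2, 3}: the pairs
    with sum 3, those with odd sum different from 3, and those with even sum. *)
Lemma four_vertex_matching : exists f : nat -> nat -> nat,
  [/\ forall i j, f i j = f j i, forall i j, f i j < 3
    & forall i j l, i < 4 -> j < 4 -> l < 4 -> i != j -> i != l -> f i j = f i l -> j = l].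
Proof.
exists (fun i j => if i + j == 3 then 0 else if odd (i + j) then 1 else 2).
split=> [i j|i j|i j l]; first by rewrite addnC.
  by case: ifP => // _; case: ifP.
by case: i j l => [|[|[|[|i]]]] // [|[|[|[|j]]]] // [|[|[|[|l]]]].
Qed.

(** With five vertices or more, two of them miss the same color of a Vizing
    coloring by the pigeonhole principle. Up to four vertices, the coloring by
    perfect matchings leaves the fourth color unused. The last clause serves the
    comparison with the apex in [cone_coloring_large]: on three vertices, the
    pendant colors x, s x and q may be all of them. *)
Lemma edge_coloring_common_free (H : sgraph) : subcubic H -> 2 < #|H| ->
  exists (f : H -> H -> 'I_4) (a : 'I_4) (p q : H),
  [/\ forall x y, f x y = f y x,
      forall x y z, adj x y -> adj x z -> f x y = f x z -> y = z,
      p != q, forall x y, f x y = a -> adj x y -> (x != p) && (x != q)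
    & #|H| <= 3 -> forall x y, adj x y -> f x y != a].
Proof.
move=> cub H3; have deg x := leq_trans (degree_le x) cub.
have [H4|H4] := leqP #|H| 4.
  have [g [gsym glt gpe]] := four_vertex_matching.
  have rk (x : H) : rank x < 4 := leq_trans (rank_lt x) H4.
  have [p [q [_ _ pq]]] : exists p q, [/\ p \in H, q \in H & p != q].
    by apply/card_gt1P; apply: ltnW.
  exists (fun x y => inord (g (rank x) (rank y))), ord_max, p, q.
  have na (x y : H) : inord (g (rank x) (rank y)) != ord_max :> 'I_4.
    by rewrite -val_eqE /= inordK ?neq_ltn ?glt // (leq_trans (glt _ _)).
  have rne (x y : H) : adj x y -> rank x != rank y.
    apply: contraTneq => /rank_inj ->; by rewrite adj_irr.
  split=> // [x y|x y z xy xz|x y /eqP]; first by rewrite gsym.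
    move/(congr1 val); rewrite /= !inordK ?(leq_trans (glt _ _)) // => /gpe e.
    by apply: rank_inj; apply: e; rewrite ?rk ?rne.
  by rewrite (negPf (na x y)).
have [f [sym pe]] := edge_coloring deg (leqnn 3).
have [m mP] := missing_color f deg.
have : ~~ injectiveb m.
  by apply/negP => /injectiveP /leq_card; rewrite card_ord leqNgt H4.
case/injectivePn => p [q pq mpq]; exists f, (m p), p, q; split=> // [x y fa xy|]; last first.
  by move=> H3'; move: H4; rewrite ltnNge leqW.
have := mP x y xy; rewrite fa => h.
by apply/andP; split; apply: contraNneq h => ->; rewrite ?mpq.
Qed.

Section ConeColoring.
Variable H : sgraph.
Implicit Types (cv : H -> H + 'I_3) (ce : H -> H -> H + 'I_3).

(** The colors seen by u in the cone over H, where the edge from the apex to u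
    has color [inl u]; the apex itself has color [inr ord0] and sees the colors
    [apex_sees]. *)
Definition cone_sees cv ce u a := (a == inl u) || sees cv ce u a.

Definition apex_sees (a : H + 'I_3) := if a is inr i then i == ord0 else true.

Definition cone_coloring cv ce :=
  [/\ proper_coloring cv ce,
      forall x, (cv x != inl x) && (cv x != inr ord0),
      forall x y, adj x y -> ce x y != inl x,
      forall x y, adj x y -> ~ cone_sees cv ce x =1 cone_sees cv ce y
    & forall x, ~ cone_sees cv ce x =1 apex_sees].

(** Too few vertices for a permutation without fixed points or 2-cycles; but here
    the two colors that the apex does not see suffice for the vertices. *)
Lemma cone_coloring_small : #|H| <= 2 -> exists cv ce, cone_coloring cv ce.
Proof.
move=> H2; have rk (x : H) : rank x < 2 := leq_trans (rank_lt x) H2.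
have rk1 (x : H) : (rank x).+1 < 3 by rewrite ltnS.
pose cv (x : H) : H + 'I_3 := inr (inord (rank x).+1).
pose ce (x y : H) : H + 'I_3 := inr ord0.
have cvE x y : cv x = cv y -> x = y.
  case=> /(congr1 val); rewrite /= !inordK ?rk1 // => -[].
  by move=> /rank_inj.
have inr_cv x : cv x != inr ord0 by apply/eqP => -[/(congr1 val)]; rewrite /= inordK ?rk1.
have seesl x z : cone_sees cv ce x (inl z) = (z == x).
  rewrite /cone_sees orbC; case: seesP => [[//|[w _ //]]|_] //.
have adjne (x y : H) : adj x y -> x != y by apply: contraTneq => ->; rewrite adj_irr.
exists cv, ce; split=> [|x|//|x y xy /(_ (inl x))|x /(_ (cv x))].
- split=> // [x y xy|x y xy|x y z xy xz _].
  + by apply: contraTneq xy => /cvE ->; rewrite adj_irr.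
  + by rewrite eq_sym inr_cv.
  + have rne (u w : H) : u != w -> rank u != rank w.
      by apply: contra_neq => /rank_inj.
    have [//|yz] := eqVneq y z.
    have := rne _ _ yz; have := rne _ _ (adjne _ _ xy); have := rne _ _ (adjne _ _ xz).
    by have := rk x; have := rk y; have := rk z; lia.
- by rewrite inr_cv.
- by rewrite !seesl eqxx => /esym/eqP e; have := adjne _ _ xy; rewrite e eqxx.
- have -> : cone_sees cv ce x (cv x) by rewrite /cone_sees /sees eqxx orbT.
  by move=> /esym/eqP e; have /eqP := inr_cv x; apply; rewrite /cv e.
Qed.

(** The vertex u gets the color of the pendant edge at s u. The edge color a,
    free at p and q, is renamed [inl q], which is the color of the vertex p and
    of the pendant edge at q. *)
Lemma cone_coloring_large : subcubic H -> 2 < #|H| -> exists cv ce, cone_coloring cv ce.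
Proof.
move=> cub H3; have [f [a [p [q [sym pe pq fa few]]]]] := edge_coloring_common_free cub H3.
have [s [sinj sp sne ssne]] := cyclic_shift pq H3.
pose tau (b : 'I_4) : H + 'I_3 := if unlift a b is Some i then inr i else inl q.
have tauP b : tau b = inl q /\ b = a \/ exists2 i, tau b = inr i & b = lift a i.
  by rewrite /tau; case: unliftP => [i|] ->; [right; exists i|left].
have tau_inj : injective tau.
  move=> b c; case: (tauP b) => [[-> ->]|[i -> ->]]; case: (tauP c) => [[-> ->]|[j -> ->]] //.
  by case=> ->.
have taul b z : tau b = inl z -> b = a /\ z = q.
  by case: (tauP b) => [[-> ->] []|[i ->]].
pose cv x : H + 'I_3 := inl (s x); pose ce x y := tau (f x y).
have seesl x z : cone_sees cv ce x (inl z) ->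
    [\/ z = x, z = s x | z = q /\ exists2 y, adj x y & f x y = a].
  case/orP => [/eqP[]|/seesP [[]|[w xw]]]; first by constructor 1.
    by constructor 2.
  by move/esym/taul => [fxw ->]; constructor 3; split=> //; exists w.
have sees_self x : cone_sees cv ce x (inl x) by rewrite /cone_sees eqxx.
have sees_s x : cone_sees cv ce x (inl (s x)) by rewrite /cone_sees /sees eqxx orbT.
exists cv, ce; split=> [|x|x y xy|x y xy e|x e].
- split=> [x y xy|x y xy|x y xy|x y z xy xz /tau_inj].
  + by rewrite /ce sym.
  + by apply/eqP => -[/sinj e]; rewrite e adj_irr in xy.
  + apply/eqP => /taul [fxy]; rewrite -sp => /sinj ex.
    by have := fa _ _ fxy xy; rewrite ex eqxx.
  + exact: pe.
- by rewrite /cv andbT; apply/eqP => -[] /eqP; apply/negP.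
- apply/eqP => /taul [fxy ex].
  by have := fa _ _ fxy xy; rewrite ex eqxx andbF.
- have xy' : x <> y by move=> exy; rewrite exy adj_irr in xy.
  have sxy' : s x <> s y by move/sinj.
  (* The sets {x, s x} and {y, s y} agree outside q; as s has no fixed points and
     no 2-cycles, this forces x = y. *)
  have := sees_self x; rewrite e => /seesl.
  have := sees_s x; rewrite e => /seesl.
  have := sees_self y; rewrite -e => /seesl.
  have := sees_s y; rewrite -e => /seesl.
  have sx := elimN eqP (sne x); have sy := elimN eqP (sne y).
  have ssx := elimN eqP (ssne x); have ssy := elimN eqP (ssne y).
  move=> [E1|E1|[E1 _]] [E2|E2|[E2 _]] [E3|E3|[E3 _]] [E4|E4|[E4 _]]; congruence.
(* The apex sees every pendant color, while x misses the color z. *)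
- have [z [zx zsx zq]] : exists z, [/\ z <> x, z <> s x & z = q -> #|H| <= 3].
    have [H3'|H4] := leqP #|H| 3.
      by exists (s (s x)); split=> //; apply/eqP; rewrite ?ssne // sne.
    have : 0 < #|~: [set x; s x; q]|.
      rewrite cardsCs setCK subn_gt0; apply: leq_ltn_trans H4.
      by rewrite -setUA cardsU1 cards2; case: (_ \notin _); case: (_ != _).
    case/card_gt0P => z; rewrite !inE !negb_or => /andP [/andP [/eqP zx /eqP zsx] /eqP zq].
    by exists z; split.
  have := e (inl z); rewrite /apex_sees => /seesl [//|//|[/zq H3' [y xy fxy]]].
  by have := few H3' _ _ xy; rewrite fxy eqxx.
Qed.
End ConeColoring.

Lemma cone_coloring_ex (H : sgraph) : subcubic H -> exists cv ce, @cone_coloring H cv ce.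
Proof.
move=> cub; have [H2|H3] := leqP #|H| 2; first exact: cone_coloring_small.
exact: cone_coloring_large.
Qed.

(** * Coloring the corona product *)

Section CoronaColoring.
Variables (G H : sgraph) (b : nat).
Variables (f : G -> G -> 'I_b) (m : G -> 'I_b) (q : G -> 'I_4).
Hypothesis f_sym : forall x y, f x y = f y x.
Hypothesis f_proper : forall x y z, adj x y -> adj x z -> f x y = f x z -> y = z.
Hypothesis m_free : forall x y, adj x y -> f x y != m x.
Hypothesis q_proper : forall x y, adj x y -> q x != q y.
Variables (hv : H -> H + 'I_3) (he : H -> H -> H + 'I_3).
Hypothesis h_cone : cone_coloring hv he.

(** The list b, b + 1, b + 2, m v, read cyclically from position q v: entry 0 is
    the color of v, entry 1 the color of the pendant edge of rank 0 at v, and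
    entries 2 and 3 are not seen by v. *)
Definition reserve (v : G) (i : nat) : nat :=
  if (q v + i) %% 4 == 3 then m v : nat else b + (q v + i) %% 4.

(** The actual color, in the copy of H attached to v, of a color of the abstract
    palette. The shift by [0 < i] skips entry 1, which belongs to a pendant
    edge. *)
Definition translate (v : G) (z : H + 'I_3) : nat :=
  match z with
  | inl u => if rank u == 0 then reserve v 1 else b + 2 + rank u
  | inr i => reserve v (i + (0 < i))
  end.

Definition corona_vertex_color (x : corona G H) : nat :=
  match x with
  | inl v => reserve v 0
  | inr (v, u) => translate v (hv u)
  end.

Definition corona_edge_color (x y : corona G H) : nat :=
  match x, y with
  | inl v, inl w => f v w
  | inl _, inr (w, u) => translate w (inl u)
  | inr (v, u), inl _ => translate v (inl u)
  | inr (v, a), inr (_, c) => translate v (he a c)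
  end.

Lemma reserve_lt v i : reserve v i < b + 3.
Proof. by rewrite /reserve; have := ltn_ord (m v); case: ifP; lia. Qed.

Lemma reserve_inj v i j : reserve v i = reserve v j -> i < 4 -> j < 4 -> i = j.
Proof. by rewrite /reserve; have := ltn_ord (m v); case: ifP; case: ifP; lia. Qed.

Lemma reserve_extra v i j : j < 3 -> (reserve v i == b + j) = ((q v + i) %% 4 == j).
Proof. by rewrite /reserve; have := ltn_ord (m v); case: ifP; lia. Qed.

Lemma translate_inj v : injective (translate v).
Proof.
move=> [u|i] [w|j] /=.
- case: ifP => /eqP ru; case: ifP => /eqP rw e.
  + by congr inl; apply: rank_inj; rewrite ru rw.
  + by have := reserve_lt v 1; lia.
  + by have := reserve_lt v 1; lia.
  + by congr inl; apply: rank_inj; lia.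
- have j3 := ltn_ord j; have j4 : j + (0 < j) < 4 by lia.
  case: ifP => /eqP r0 e; last by have := reserve_lt v (j + (0 < j)); lia.
  by have := reserve_inj e isT j4; lia.
- have i3 := ltn_ord i; have i4 : i + (0 < i) < 4 by lia.
  case: ifP => /eqP r0 e; last by have := reserve_lt v (i + (0 < i)); lia.
  by have := reserve_inj e i4 isT; lia.
- have i3 := ltn_ord i; have j3 := ltn_ord j; move=> e; congr inr; apply/val_inj => /=.
  have i4 : i + (0 < i) < 4 by lia.
  have j4 : j + (0 < j) < 4 by lia.
  by have := reserve_inj e i4 j4; lia.
Qed.

Lemma translate_lt v z : translate v z < b + 2 + #|H|.
Proof.
have reserve_le i : reserve v i < b + 2 + #|H|.
  by apply: leq_trans (reserve_lt v i) _; rewrite -addnA leq_add2l (leq_add (leqnn 2)) ?sgraph_gt0.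
case: z => [u|i] //=; case: ifP => // _.
by rewrite ltn_add2l rank_lt.
Qed.

(** The reserved colors are extra colors or the edge color missing at v. *)
Lemma edge_not_reserve v w i : adj v w -> (f v w : nat) != reserve v i.
Proof.
move=> vw; have := m_free vw; rewrite -val_eqE /reserve /=.
by have := ltn_ord (f v w); case: ifP; lia.
Qed.

Lemma edge_not_translate v w z : adj v w -> (f v w : nat) != translate v z.
Proof.
case: z => [u|i] vw /=; last exact: edge_not_reserve.
case: ifP => _; first exact: edge_not_reserve.
by have := ltn_ord (f v w); lia.
Qed.

Arguments translate : simpl never.

Lemma reserve0 v : reserve v 0 = translate v (inr ord0).
Proof. by []. Qed.

Lemma corona_proper : proper_coloring corona_vertex_color corona_edge_color.
Proof.
have [[hsym hpv hpve hpe] hv1 he1 _ _] := h_cone.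
split.
- move=> [v|[v a]] [w|[w c]] //= vw; first by rewrite f_sym.
  by case/andP: vw => /eqP -> /hsym ->.
- move=> [v|[v a]] [w|[w c]] //=.
  + move=> vw; have := q_proper vw; rewrite -val_eqE /reserve /=.
    have := ltn_ord (q v); have := ltn_ord (q w); have := ltn_ord (m v); have := ltn_ord (m w).
    by case: ifP; case: ifP; lia.
  + move/eqP=> ->; rewrite reserve0 (inj_eq (@translate_inj w)) eq_sym.
    by case/andP: (hv1 c).
  + move/eqP=> ->; rewrite reserve0 (inj_eq (@translate_inj w)).
    by case/andP: (hv1 a).
  + by case/andP=> /eqP -> ac; rewrite (inj_eq (@translate_inj w)) hpv.
- move=> [v|[v a]] [w|[w c]] //=.
  + by move=> vw; rewrite reserve0 edge_not_translate.
  + by move/eqP=> ->; rewrite reserve0 (inj_eq (@translate_inj w)).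
  + by move=> _; rewrite (inj_eq (@translate_inj v)) eq_sym; case/andP: (hv1 a).
  + by case/andP=> _ ac; rewrite (inj_eq (@translate_inj v)) hpve.
- move=> [v|[v a]] [w|[w c]] [x|[x d]] //=.
  + by move=> vw vx /val_inj/f_proper ->.
  + by move=> vw /eqP <- /eqP; rewrite (negPf (edge_not_translate _ vw)).
  + by move=> /eqP <- vw /esym/eqP; rewrite (negPf (edge_not_translate _ vw)).
  + by move=> /eqP <- /eqP <- /translate_inj [->].
  + by move=> /eqP -> /eqP ->.
  + by move=> _ /andP [_ ad] /translate_inj/esym/eqP; rewrite (negPf (he1 _ _ ad)).
  + by move=> /andP [_ ad] _ /translate_inj/eqP; rewrite (negPf (he1 _ _ ad)).
  + by move=> /andP [/eqP <- ac] /andP [/eqP <- ad] /translate_inj /(hpe _ _ _ ac ad) ->.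
Qed.

Notation seen := (sees corona_vertex_color corona_edge_color).

Lemma sees_copy v u z : seen (inr (v, u)) (translate v z) = cone_sees hv he u z.
Proof.
apply/seesP/orP => [[/translate_inj ->|[[w|[w c]] /=]]|].
- by right; apply/seesP; left.
- by move=> _ /translate_inj ->; left.
- by case/andP=> _ uc /translate_inj ->; right; apply/seesP; right; exists c.
case=> [/eqP->|/seesP [->|[w uw ->]]]; [right|left|right] => //.
  by exists (inl v) => /=.
by exists (inr (v, w)); rewrite //= eqxx.
Qed.

(** Within the palette of its copy of H, the vertex v sees what the apex of the
    cone sees; this is where the absence of entries 2 and 3 at v is used. *)
Lemma sees_base v z : seen (inl v) (translate v z) = apex_sees z.
Proof.
apply/seesP/idP => [[|[[w|[w u]] /= vw]]|].
- by rewrite /= reserve0 => /translate_inj ->.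
- by move/esym/eqP; rewrite (negPf (edge_not_translate _ vw)).
- by rewrite -(eqP vw) => /translate_inj ->.
case: z => [u _|i /eqP ->]; [right|left] => //.
by exists (inr (v, u)) => /=.
Qed.

(** The extra colors seen by v are at positions q v and q v + 1 modulo 4 of the
    list, where position 3 is not an extra color. They determine q v. *)
Lemma sees_base_extra v j : j < 3 ->
  seen (inl v) (b + j) = (q v == j :> nat) || ((q v + 1) %% 4 == j).
Proof.
move=> j3; have q4 : (q v + 0) %% 4 = q v by rewrite addn0 modn_small.
rewrite -{1}q4 -!reserve_extra //.
apply/seesP/orP => [[->|[[w|[w u]] /= vw]]|[/eqP<-|/eqP<-]].
- by left.
- by have := ltn_ord (f v w); lia.
- rewrite -(eqP vw) /translate; case: ifP => /eqP u0 e; last by lia.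
  by right; rewrite e.
- by left.
have [u u0] := rank_eq0 H.
by right; exists (inr (v, u)); rewrite //= /translate u0.
Qed.

Lemma corona_distinguishing x y : adj x y -> ~ seen x =1 seen y.
Proof.
have [_ _ _ hd ha] := h_cone.
case: x y => [v|[v a]] [w|[w c]] /= xy e.
- have := q_proper xy; rewrite -val_eqE /=.
  have ql := ltn_ord (q v); have ql' := ltn_ord (q w).
  have := e (b + 0); have := e (b + 1); have := e (b + 2).
  rewrite !sees_base_extra //.
  by case: (q v : nat) ql (q w : nat) ql' => [|[|[|[|?]]]] // _ [|[|[|[|?]]]].
- by apply: (ha c) => z; rewrite -(sees_copy w) -(sees_base w) -e (eqP xy).
- by apply: (ha a) => z; rewrite -(sees_copy v) -(sees_base v) e (eqP xy).
- case/andP: xy => /eqP evw ac; apply: (hd _ _ ac) => z.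
  by rewrite -!(sees_copy v) e evw.
Qed.

Lemma corona_colorable : nvd_total_colorable (corona G H) (b + 2 + #|H|).
Proof.
apply: (nvd_total_colorable_intro (cv := corona_vertex_color) (ce := corona_edge_color)).
- by move=> [v|[v u]]; rewrite /= ?reserve0 translate_lt.
- move=> [v|[v a]] [w|[w c]] _ //=; rewrite ?translate_lt //; try exact: (translate_lt _ (inl _)).
  by have := ltn_ord (f v w); lia.
- exact: corona_proper.
- exact: corona_distinguishing.
Qed.

End CoronaColoring.

Lemma max_degree_corona (G H : sgraph) : max_degree G + #|H| <= max_degree (corona G H).
Proof.
have [v ev] : exists v : G, max_degree G = #|[set w | adj v w]|.
  have [v _ e] := eq_bigmax_cond (fun v : G => #|[set w | adj v w]|) (sgraph_gt0 G).
  by exists v.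
rewrite ev; apply: leq_trans (degree_le (inl v : corona G H)).
have inl_inj : injective (inl : G -> corona G H) by move=> ? ? [].
have inr_inj : injective (fun u : H => inr (v, u) : corona G H) by move=> ? ? [].
rewrite -(card_imset _ inl_inj) -cardsT -(card_imset _ inr_inj).
rewrite -cardsUI [X in _ + X](_ : _ = 0) ?addn0.
  apply/subset_leq_card/subsetP => x; rewrite !inE => /orP [] /imsetP [y + ->].
    by rewrite inE.
  by rewrite /=.
apply/eqP; rewrite cards_eq0; apply/eqP/setP => x; rewrite !inE.
by apply/negP => /andP [/imsetP [y _ ->] /imsetP []].
Qed.

Theorem corollary1p2 (G H : sgraph) (hG : subcubic G) (hH : subcubic H) :
  tndi (corona G H) <= max_degree (corona G H) + 3.
Proof.
have degG := @degree_le G; have deg3 x := leq_trans (degG x) hG.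
have [f [f_sym f_proper]] := edge_coloring degG hG.
have [m m_free] := missing_color f degG.
have [q q_proper] := vertex_coloring deg3.
have [hv [he h_cone]] := cone_coloring_ex hH.
have col := corona_colorable f_sym f_proper m_free q_proper h_cone.
have [_ _ least] := tndiP (corona G H).
apply: leq_trans (least _ _ col) _; first by rewrite addn_gt0 sgraph_gt0 orbT.
by have := max_degree_corona G H; lia.
Qed.
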